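(* Let $\mathcal U\subset\mathbb R^{n_\xi}$ be convex (and compact), and let $f:\mathcal X\times\mathcal Y\times\mathcal U\to\mathbb R$ be a continuous function such that $\xi\mapsto f(x,y,\xi)$ is concave on $\mathcal U$ for every $x\in\mathcal X$, $y\in\mathcal Y$. Let $k\in\mathbb N$ with $k\ge n_\xi+1$. Then a solution $x\in\mathcal X$ is optimal for the $k$-adaptability problem $$\inf_{\substack{x\in\mathcal X\\ y^1,\ldots,y^k\in\mathcal Y(x)}}\ \sup_{\xi\in\mathcal U}\ \inf_{i=1,\ldots,k} f(x,y^i,\xi)$$ if and only if it is optimal for the two-stage robust problem $$\inf_{x\in\mathcal X}\ \sup_{\xi\in\mathcal U}\ \inf_{y\in\mathcal Y(x)} f(x,y,\xi).$$
   Context: $\mathcal X\subseteq\mathbb R^{n_x}$ is a nonempty compact set, $\mathcal Y\subset\mathbb Z^{n_y}$ is a bounded (hence finite) set, for each $x\in\mathcal X$ a nonempty set $\mathcal Y(x)\subseteq\mathcal Y$ of feasible second-stage decisions is given, and $\mathcal U\subset\mathbb R^{n_\xi}$ is a nonempty compact set. A point $x\in\mathcal X$ is called optimal for the two-stage robust problem if it attains the outer infimum, i.e. $\sup_{\xi\in\mathcal U}\inf_{y\in\mathcal Y(x)}f(x,y,\xi)$ equals the optimal value. It is called optimal for the $k$-adaptability problem if $\inf_{y^1,\ldots,y^k\in\mathcal Y(x)}\sup_{\xi\in\mathcal U}\inf_{i\in\{1,\ldots,k\}}f(x,y^i,\xi)$ equals the optimal value of that problem. The $y^i$ need not be distinct.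 *)

(* Defs.v *)
From HB Require Import structures.
From mathcomp Require Import all_boot all_order all_algebra.
From mathcomp Require Import all_classical all_reals all_analysis.

Set Implicit Arguments.
Unset Strict Implicit.
Unset Printing Implicit Defensive.

Import Order.TTheory GRing.Theory Num.Theory.
Import numFieldNormedType.Exports.

Local Open Scope classical_set_scope.
Local Open Scope ring_scope.
Local Open Scope convex_scope.

(* Mirror image of [convex_function]. *)
Definition concave_function (R : numFieldType) (E : lmodType R)
    (E' := convex_lmodType E) (D : set E') (f : E' -> R^o) :=
  forall t : {i01 R},
    {in D &, forall x y : E', f x <| t |> f y <= f (x <| t |> y)}.

(* First-stage decisions, second-stage decisions and scenarios live in
   ambient spaces V, W, S. All infima and suprema are taken in \bar R, where
   they always exist; [Yx x] is the set of second-stage decisions feasible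
   for [x]. *)
Section RobustProblems.
Context {R : realType} {V W S : Type}.
Variables (X : set V) (Yx : V -> set W) (U : set S) (f : V -> W -> S -> R).

Definition two_stage_cost (x : V) : \bar R :=
  ereal_sup [set ereal_inf [set (f x y xi)%:E | y in Yx x] | xi in U].

Definition two_stage_value : \bar R :=
  ereal_inf [set two_stage_cost x | x in X].

Definition two_stage_optimal (x : V) : Prop :=
  X x /\ two_stage_cost x = two_stage_value.

Definition policy_cost k (x : V) (ys : 'I_k -> W) : \bar R :=
  ereal_sup [set ereal_inf [set (f x (ys i) xi)%:E | i in [set: 'I_k]]
            | xi in U].

Definition feasible_policies k (x : V) : set ('I_k -> W) :=
  [set ys | forall i, Yx x (ys i)].

Definition kadapt_cost k (x : V) : \bar R :=
  ereal_inf [set policy_cost x ys | ys in @feasible_policies k x].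

(* The infimum is taken jointly over [x] and the [k] policies. *)
Definition kadapt_value k : \bar R :=
  ereal_inf [set policy_cost p.1 p.2
            | p in [set p : V * ('I_k -> W) |
                     X p.1 /\ feasible_policies p.1 p.2]].

Definition kadapt_optimal k (x : V) : Prop :=
  X x /\ kadapt_cost k x = kadapt_value k.

End RobustProblems.

(* Main.v *)
(* The two costs agree for every feasible [x]. Restricting to [k] policies can
   only increase the cost. Conversely, for a real [r] above the two-stage cost,
   the sets [{xi in U | r <= f x y xi}], with [y] in the finite set [Yx x], are
   convex and have no common point. By Helly's theorem some [nxi + 1] of them
   already have no common point, and the corresponding [y]s form a policy of
   cost at most [r]. Helly's theorem is proved from Radon's: [n + 2] points of
   an [n]-dimensional space split into two families with intersecting hulls. *)
Require Import Defs.
From HB Require Import structures.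
From mathcomp Require Import all_boot all_order all_algebra.
From mathcomp Require Import ring zify.
From mathcomp Require Import all_classical all_reals all_analysis.

Set Implicit Arguments.
Unset Strict Implicit.
Unset Printing Implicit Defensive.

Import Order.TTheory GRing.Theory Num.Theory.
Import numFieldNormedType.Exports.

Local Open Scope classical_set_scope.
Local Open Scope ring_scope.

(** * Barycenters in convex sets, Radon's theorem and Helly's theorem *)

Section Helly.
Variable R : realFieldType.

Lemma convex_set_barycenter2 (E : lmodType R) (D : set (convex_lmodType E))
    (a b : R) (x y : E) :
  convex_set D -> 0 < a -> 0 <= b -> D x -> D y ->
  D ((a + b)^-1 *: (a *: x + b *: y)).
Proof.
move=> Dcvx a0 b0 Dx Dy; have ab0 : 0 < a + b by rewrite ltr_wpDr.
have t0 : 0 <= a / (a + b) by rewrite divr_ge0 ?ltW.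
have t1 : a / (a + b) <= 1 by rewrite ler_pdivrMr// mul1r lerDl.
have tE : 1 - a / (a + b) = (a + b)^-1 * b by field; rewrite gt_eqF.
have := Dcvx x y (Itv01 t0 t1) (mem_set Dx) (mem_set Dy).
rewrite inE; congr D; rewrite scalerDr !scalerA -tE [_ * a]mulrC.
exact: erefl.
Qed.

(* Points are absorbed one at a time into a barycenter of weight [c > 0]: no
   partial sum of weights can then vanish. *)
Lemma convex_set_barycenter_seq (E : lmodType R) (D : set (convex_lmodType E))
    (I : Type) (r : seq I) (P : pred I) (w : I -> R) (p : I -> E) (c : R) (q : E) :
  convex_set D -> 0 < c -> D q -> (forall i, P i -> 0 <= w i) ->
  (forall i, P i -> D (p i)) ->
  D ((c + \sum_(i <- r | P i) w i)^-1 *: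
     (c *: q + \sum_(i <- r | P i) w i *: p i)).
Proof.
move=> Dcvx c0 Dq w0 Dp; elim: r c q c0 Dq => [|i r IH] c q c0 Dq.
  by rewrite !big_nil !addr0 scalerA mulVf ?gt_eqF// scale1r.
rewrite !big_cons; case: ifPn => Pi; last exact: IH.
have cw0 : 0 < c + w i by rewrite ltr_wpDr// w0.
have := IH _ _ cw0 (convex_set_barycenter2 Dcvx c0 (w0 _ Pi) Dq (Dp _ Pi)).
by rewrite scalerA mulfV ?gt_eqF// scale1r !addrA.
Qed.

(** The term of [i0] is split off to serve as the starting point of positive weight. *)
Lemma convex_set_barycenter (E : lmodType R) (D : set (convex_lmodType E))
    (I : finType) (P : pred I) (w : I -> R) (p : I -> E) (i0 : I) :
  convex_set D -> P i0 -> (forall i, P i -> 0 < w i) ->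
  (forall i, P i -> D (p i)) ->
  D ((\sum_(i | P i) w i)^-1 *: \sum_(i | P i) w i *: p i).
Proof.
move=> Dcvx Pi0 w0 Dp; rewrite (bigD1 i0)//= [X in _ *: X](bigD1 i0)//=.
apply: convex_set_barycenter_seq => //; [exact: w0|exact: Dp| |].
- by move=> i /andP[/w0/ltW].
- by move=> i /andP[/Dp].
Qed.

(** With a coordinate 1 appended, the points are more than [n + 1] rows of length [n + 1], hence
    linearly dependent; the added column says that the coefficients sum to 0. *)
Lemma affine_dependence (m n : nat) (p : 'I_m -> 'rV[R]_n) : (n + 1 < m)%N ->
  exists w : 'I_m -> R, [/\ \sum_i w i = 0, \sum_i w i *: p i = 0 &
    exists i, w i != 0].
Proof.
move=> nm; pose M : 'M[R]_(m, n + 1) := \matrix_i row_mx (p i) 1.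
have : kermx M != 0.
  by rewrite kermx_eq0 -row_leq_rank -ltnNge (leq_ltn_trans (rank_leq_col _)).
move=> /rowV0Pn[u /sub_kermxP uM u0]; exists (u 0).
have : \sum_i u 0 i *: row_mx (p i) (1 : 'rV[R]_1) = 0.
  by apply: etrans uM; rewrite mulmx_sum_row; apply: eq_bigr => i _; rewrite rowK.
under eq_bigr do rewrite scale_row_mx.
have -> : \sum_i row_mx (u 0 i *: p i) (u 0 i *: (1 : 'rV[R]_1)) =
    row_mx (\sum_i u 0 i *: p i) ((\sum_i u 0 i) *: 1).
  apply: (big_rec3 (fun a b c => a = row_mx b (c *: (1 : 'rV[R]_1)))).
    by rewrite scale0r row_mx0.
  by move=> i a b c _ ->; rewrite add_row_mx scalerDl.
move/eqP; rewrite row_mx_eq0 => /andP[/eqP pu /eqP su]; split=> //.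
  by move/rowP : su => /(_ 0); rewrite !mxE mulr1.
apply/existsP; rewrite -negb_forall; apply: contra u0 => /forallP u0.
by apply/eqP/rowP => i; rewrite mxE; apply/eqP/u0.
Qed.

Lemma sum0_exists_gt0 (I : finType) (w : I -> R) (i0 : I) :
  \sum_i w i = 0 -> w i0 != 0 -> exists i, 0 < w i.
Proof.
move=> sw; apply: contraNP => /forallNP wle0.
have /psumr_eq0P H i : true -> 0 <= - w i.
  by move=> _; rewrite oppr_ge0 leNgt; apply/negP.
by rewrite -oppr_eq0; apply/eqP/H; rewrite // sumrN sw oppr0.
Qed.

Lemma sum0_split_sign (I : finType) (E : lmodType R) (w : I -> R) (p : I -> E) :
  \sum_i w i *: p i = 0 ->
  \sum_(i | 0 < w i) w i *: p i = \sum_(i | w i < 0) - w i *: p i.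
Proof.
rewrite (bigID (fun i => 0 < w i))/= => /eqP; rewrite addr_eq0 => /eqP ->.
rewrite -sumrN big_mkcond [RHS]big_mkcond; apply: eq_bigr => i _.
by case: ltrgt0P => [_|_|->] /=; rewrite ?scaleNr// scale0r oppr0.
Qed.

(** Membership of [q] in a hull is expressed through all convex sets [D] that contain the family.
    The family [P] carries the positive weights of an affine dependence, and [q] is its barycenter;
    moving the negative terms across shows that [q] is also a barycenter of the other family. *)
Lemma radon (m n : nat) (p : 'I_m -> 'rV[R]_n) : (n + 1 < m)%N ->
  exists (P : pred 'I_m) (q : 'rV[R]_n),
    forall D : set (convex_lmodType 'rV[R]_n), convex_set D ->
    ((forall i, P i -> D (p i)) -> D q) /\
    ((forall i, ~~ P i -> D (p i)) -> D q).
Proof.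
move=> /affine_dependence -/(_ p)[w [sw swp [i0 wi0]]].
(* The total weights are compared by applying [sum0_split_sign] to the constant point 1 of [R^o]. *)
have wE : \sum_(i | 0 < w i) w i = \sum_(i | w i < 0) - w i.
  under eq_bigr do rewrite -[w _]mulr1.
  under [RHS]eq_bigr do rewrite -[- w _]mulr1.
  apply: (@sum0_split_sign _ R^o _ (fun=> 1)).
  by rewrite -[RHS]sw; apply: eq_bigr => i _; exact: mulr1.
have [i wi] := sum0_exists_gt0 sw wi0.
have [j wj] : exists j, 0 < - w j.
  by apply: (@sum0_exists_gt0 _ _ i0); rewrite ?sumrN ?sw ?oppr0// oppr_eq0.
exists (fun i => 0 < w i).
exists ((\sum_(i | 0 < w i) w i)^-1 *: \sum_(i | 0 < w i) w i *: p i).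
move=> D Dcvx; split=> Dp.
  exact: (convex_set_barycenter (i0 := i)).
rewrite wE (sum0_split_sign swp); apply: (convex_set_barycenter (i0 := j)) => //.
- by rewrite -oppr_gt0.
- by move=> l; rewrite oppr_gt0.
- by move=> l wl; apply: Dp; rewrite -leNgt ltW.
Qed.

(** Since [h] may repeat indices, the hypothesis also covers subfamilies with fewer than [n + 1]
    members. The induction is on a bound for the size of a subfamily [A]. *)
Lemma helly (I : finType) (n : nat)
    (C : I -> set (convex_lmodType 'rV[R]_n)) :
  (forall i, convex_set (C i)) ->
  (forall h : 'I_(n + 1) -> I, exists q, forall i, C (h i) q) ->
  exists q, forall i, C i q.
Proof.
move=> Ccvx Csmall.
suff H m (A : {set I}) : (#|A| <= m)%N -> exists q, forall i, i \in A -> C i q.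
  have [q Cq] := H _ _ (leqnn #|finset.setTfor I|).
  by exists q => i; apply: Cq; rewrite inE.
elim: m A => [|m IH] A.
  by rewrite leqn0 cards_eq0 => /eqP ->; exists 0 => i; rewrite inE.
move=> Am; have [An|An] := leqP #|A| (n + 1).
  have [->|[i0 _]] := set_0Vmem A; first by exists 0 => i; rewrite inE.
  (* The list of [A] is padded with [i0] up to length [n + 1]. *)
  have [q Cq] := Csmall (fun i => nth i0 (enum A) i).
  exists q => i iA.
  have iAn : (index i (enum A) < n + 1)%N.
    by rewrite (leq_trans _ An)// cardE index_mem mem_enum.
  by have := Cq (Ordinal iAn); rewrite /= nth_index// mem_enum.
have /choice[p Cp] (i : 'I_#|A|) :
    exists q, forall j, j \in A :\ enum_val i -> C j q.
  apply: IH; rewrite -ltnS (leq_trans _ Am)// [leqRHS](cardsD1 (enum_val i)).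
  by rewrite enum_valP.
have [P [q Pq]] := radon p An.
(* [C j] contains every [p i] except possibly the one built by omitting [j], so it contains all of
   the Radon family without that point, and therefore [q]. *)
exists q => j jA; have [Pin Pout] := Pq _ (Ccvx j).
have Cjp i : i != enum_rank_in jA j -> C j (p i).
  move=> ij; apply: Cp; rewrite !inE jA andbT; apply: contraNneq ij => ji.
  by apply/eqP/enum_val_inj; rewrite enum_rankK_in.
have [Pj|Pj] := boolP (P (enum_rank_in jA j)).
  by apply: Pout => i Pi; apply: Cjp; apply: contraNneq Pi => ->.
by apply: Pin => i Pi; apply: Cjp; apply: contraTneq Pi => ->.
Qed.

End Helly.

(** Entries lie strictly between [-N] and [N]; shifted by [N] they become ordinals below [2N + 1],
    so [Y] lies in the image of a finite type of matrices. *)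
Lemma finite_bounded_integral (R : realType) (n : nat) (Y : set 'rV[R]_n) :
  (forall y, Y y -> y \is a mxOver Num.int) -> bounded_set Y -> finite_set Y.
Proof.
move=> Yint [M [_ /(_ (`|M| + 1))]].
rewrite (le_lt_trans (ler_norm M)) ?ltrDl// => /(_ isT) YM.
have [N MN] : exists N : nat, `|M| + 1 < N%:R.
  by exists (Num.bound (`|M| + 1)); rewrite archi_boundP.
pose g (A : 'M['I_(N + N).+1]_(1, n)) : 'rV[R]_n :=
  map_mx (fun i : 'I_(N + N).+1 => i%:R - N%:R) A.
apply: (@sub_finite_set _ _ (g @` setT)); last first.
  exact/finite_image/finite_finset.
move=> y Yy; have := YM _ Yy => /= yM.
pose c j := `|(Num.floor (y 0 j) + N%:Z)%R|%N.
exists (\matrix_(i, j) inord (c j)) => //.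
apply/rowP => j; rewrite !mxE.
have yj : `|y 0 j| < N%:R.
  apply: le_lt_trans MN; apply: le_trans yM.
  rewrite [leRHS]/Num.norm/= mx_normrE.
  exact: (le_bigmax _ (fun ij => `|y ij.1 ij.2|) (0, j)).
have /intrP[z yz] : y 0 j \is a Num.int by exact: (mxOverP (Yint _ Yy)).
have zN : (`|z| < N)%R.
  by rewrite -(ltr_int R) intr_norm -yz.
rewrite /c yz intrKfloor.
have cE : `|(z + N%:Z)%R|%N = z + N%:Z :> int.
  by lia.
rewrite inordK; last by lia.
by rewrite -[_%:R]/(_%:Z%:~R) cE rmorphD/= addrK.
Qed.

(** Reduces a comparison of extended reals to real levels, at which superlevel sets can be
    formed. *)
Lemma lee_fin_ub (R : realFieldType) (x y : \bar R) :
  (forall r : R, (y < r%:E)%E -> (x <= r%:E)%E) -> (x <= y)%E.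
Proof.
case: y => [y| |] xr; last 2 first.
- exact: leey.
- case: x xr => [x /(_ (x - 1))|/(_ 0)|//]; last by rewrite ltNy0 => /(_ isT).
  by rewrite ltNyr lee_fin => /(_ isT); rewrite lerBrDr gerDl ler10.
apply/lee_addgt0Pr => e e0.
by rewrite -EFinD xr// lte_fin ltrDl.
Qed.

(** * Equality of the k-adaptability and two-stage costs *)

Section Adaptability.
Context {R : realType}.

Lemma superlevel_set_convex (E : lmodType R) (U : set (convex_lmodType E))
    (g : convex_lmodType E -> R^o) (r : R) :
  convex_set U -> concave_function U g ->
  convex_set (U `&` [set xi | r <= g xi]).
Proof.
move=> Ucvx gccv x y t /set_mem[Ux rx] /set_mem[Uy ry].
apply/mem_set; split; first exact/set_mem/Ucvx/mem_set/Uy/mem_set.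
apply: le_trans (gccv t x y (mem_set Ux) (mem_set Uy)).
have rE : r = t%:num * r + (1 - t%:num) * r by rewrite -mulrDl addrC subrK mul1r.
by rewrite [leLHS]rE; apply: lerD; apply: ler_wpM2l => //; rewrite subr_ge0.
Qed.

Section AnySets.
Variables (V W S : Type) (X : set V) (Yx : V -> set W) (U : set S).
Variables (f : V -> W -> S -> R) (k : nat).

Lemma two_stage_le_kadapt_cost x :
  (two_stage_cost Yx U f x <= kadapt_cost Yx U f k x)%E.
Proof.
apply: le_ereal_inf_tmp => _ [ys ysY <-].
apply: ub_ereal_sup => _ [xi Uxi <-].
apply: le_trans (ereal_sup_ubound _); last by exists xi.
by apply: le_ereal_inf_tmp => _ [i _ <-]; apply: ereal_inf_lbound; exists (ys i).
Qed.

(** Nesting the joint infimum lets the two problems be compared one [x] at a time. *)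
Lemma kadapt_valueE :
  kadapt_value X Yx U f k = ereal_inf [set kadapt_cost Yx U f k x | x in X].
Proof.
apply/eqP; rewrite eq_le; apply/andP; split; apply: le_ereal_inf_tmp.
  move=> _ [x Xx <-]; apply: le_ereal_inf_tmp => _ [ys ysY <-].
  by apply: ereal_inf_lbound; exists (x, ys).
move=> _ [[x ys] [/= Xx ysY] <-].
apply: (@le_trans _ _ (kadapt_cost Yx U f k x)).
  by apply: ereal_inf_lbound; exists x.
by apply: ereal_inf_lbound; exists ys.
Qed.

End AnySets.

Lemma kadapt_costE (V : Type) (W : choiceType) (n : nat) (Yx : V -> set W)
    (U : set 'rV[R]_n) (f : V -> W -> 'rV[R]_n -> R) (k : nat) (x : V) :
  Yx x !=set0 -> finite_set (Yx x) -> convex_set U ->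
  (forall y, Yx x y -> concave_function U (f x y)) -> (n + 1 <= k)%N ->
  kadapt_cost Yx U f k x = two_stage_cost Yx U f x.
Proof.
move=> [y0 Yy0] /finite_seqP[s Ys] Ucvx fccv nk.
apply/eqP; rewrite eq_le two_stage_le_kadapt_cost andbT.
apply: lee_fin_ub => r vr.
pose Z := seq_sub s.
have ZY (z : Z) : Yx x (val z) by rewrite Ys; exact: (valP z).
pose C (z : Z) : set (convex_lmodType 'rV[R]_n) :=
  U `&` [set xi | r <= f x (val z) xi].
have [|nC] := pselect (forall h : 'I_(n + 1) -> Z, exists q, forall i, C (h i) q).
  move=> /(helly (fun z => superlevel_set_convex Ucvx (fccv _ (ZY z))))[q Cq].
  have CY y : Yx x y -> U q /\ r <= f x y q.
    by rewrite Ys => ys; exact: (Cq (SeqSub ys)).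
  move: vr; rewrite ltNge => /negP[].
  (* The feasible decision [y0] is what places [q] in [U]; at [q] every feasible decision costs at
     least [r]. *)
  apply: le_trans (ereal_sup_ubound _); last by exists q; first exact: (CY _ Yy0).1.
  by apply: le_ereal_inf_tmp => _ [y /CY[_ ry] <-]; rewrite lee_fin.
have [h Ch] : exists h : 'I_(n + 1) -> Z, forall q, exists i, ~ C (h i) q.
  by move/existsNP : nC => [h /forallNP Ch]; exists h => q; exact/existsNP/Ch.
move: h Ch; rewrite addn1 => h Ch.
(* [inord] fixes the indices up to [n] and sends the later ones to 0, so the surplus policies repeat
   the first. *)
pose ys (i : 'I_k) := val (h (inord i)).
apply: (@le_trans _ _ (policy_cost U f x ys)).
  by apply: ereal_inf_lbound; exists ys => // i; exact: ZY.
apply: ub_ereal_sup => _ [xi Uxi <-]; have [i nCi] := Ch xi.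
have ik : (i < k)%N by rewrite (leq_trans (ltn_ord i))// -addn1.
apply: (@le_trans _ _ (f x (val (h i)) xi)%:E).
  by apply: ereal_inf_lbound; exists (Ordinal ik) => //; rewrite /ys/= inord_val.
by rewrite lee_fin leNgt; apply/negP => /ltW rf; apply: nCi; split.
Qed.
End Adaptability.

Theorem theorem2 (R : realType) (nx ny nxi : nat)
    (X : set 'rV[R]_nx) (Y : set 'rV[R]_ny)
    (Yx : 'rV[R]_nx -> set 'rV[R]_ny) (U : set 'rV[R]_nxi)
    (f : 'rV[R]_nx -> 'rV[R]_ny -> 'rV[R]_nxi -> R) (k : nat)
    (X_nonempty : X !=set0) (X_compact : compact X)
    (Y_integral : forall y, Y y -> y \is a mxOver Num.int)
    (Y_bounded : bounded_set Y)
    (Yx_sub : forall x, X x -> Yx x `<=` Y)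
    (Yx_nonempty : forall x, X x -> Yx x !=set0)
    (U_nonempty : U !=set0) (U_compact : compact U) (U_convex : convex_set U)
    (f_continuous : {within X `*` Y `*` U,
        continuous (fun p : 'rV[R]_nx * 'rV[R]_ny * 'rV[R]_nxi =>
                      f p.1.1 p.1.2 p.2)})
    (f_concave : forall x y, X x -> Y y -> concave_function U (f x y))
    (k_large : (nxi + 1 <= k)%N)
    (x : 'rV[R]_nx) (Xx : X x) :
  kadapt_optimal X Yx U f k x <-> two_stage_optimal X Yx U f x.
Proof.
have costE z : X z -> kadapt_cost Yx U f k z = two_stage_cost Yx U f z.
  move=> Xz; apply: kadapt_costE => //; [exact: Yx_nonempty| |].
  - apply: sub_finite_set (Yx_sub _ Xz) _.
    exact: finite_bounded_integral.
  - by move=> y /(Yx_sub _ Xz); exact: f_concave.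
have valueE : kadapt_value X Yx U f k = two_stage_value X Yx U f.
  rewrite kadapt_valueE /two_stage_value; congr ereal_inf.
  by apply: eq_imagel => z /costE.
by rewrite /kadapt_optimal /two_stage_optimal costE// valueE.
Qed.
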